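(* Let $n\ge2$, fix $t\in(-1,1)$, and let $A_t$ be the $n\times n$ strictly upper triangular matrix whose $(i,j)$ entry is $(-t)^{j-i-1}$ for $j>i$ and $0$ for $j\le i$. Then $W(A_t)$ contains the curve parameterized by $$\sum_{k=1}^{n-1} a_{n,k}(-t)^{k-1}e^{isk},\qquad s\in[0,2\pi),$$ where $a_{n,1}=\cos\left(\frac{\pi}{n+1}\right)$ and, more generally, for $1\le k\le n-1$, $$a_{n,k} = \frac{1}{(n+1)\sin\left(\frac{\pi}{n+1}\right)}\left((n-k)\cos\left(\tfrac{k\pi}{n+1}\right)\sin\left(\tfrac{\pi}{n+1}\right)+\sin\left(\tfrac{\pi(n-k)}{n+1}\right)\right).$$
   Context: For an $n\times n$ complex matrix $A$, the numerical range is $W(A)=\{\langle Ax,x\rangle : x\in\mathbb{C}^n, \|x\|=1\}$. The convention $(-t)^0=1$ is used, also when $t=0$. *)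

(* Defs.v *)
From mathcomp Require Import all_boot all_order all_algebra.
From mathcomp Require Import spectral complex.
From mathcomp Require Import boolp classical_sets set_interval reals trigo.

Set Implicit Arguments.
Unset Strict Implicit.
Unset Printing Implicit Defensive.

Import Order.TTheory GRing.Theory Num.Theory.

Local Open Scope classical_set_scope.
Local Open Scope ring_scope.
Local Open Scope complex_scope.

(* [dotmx] lives on row vectors, hence the transposes; it is linear in its
   first argument and conjugate-linear in the second. *)
Definition inner_product (C : numClosedFieldType) (n : nat) (x y : 'cV[C]_n) : C :=
  dotmx x^T y^T.

Definition euclidean_norm (C : numClosedFieldType) (n : nat) (x : 'cV[C]_n) : C :=
  sqrtC (inner_product x x).

Definition numerical_range (C : numClosedFieldType) (n : nat) (A : 'M[C]_n) : set C :=
  [set inner_product (A *m x) x | x in [set x : 'cV[C]_n | euclidean_norm x = 1]].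

(* Indices start at 0, which leaves [j - i - 1] unchanged; the truncated
   subtraction is only used for [i < j], where it is exact. *)
Definition A_mx (R : realType) (n : nat) (t : R) : 'M[R[i]]_n :=
  \matrix_(i < n, j < n) (if (i < j)%N then ((- t) ^+ (j - i - 1))%:C else 0).

(* e^(i theta), through Euler's formula. *)
Definition expi (R : realType) (theta : R) : R[i] := cos theta +i* sin theta.

Definition a_coef (R : realType) (n k : nat) : R :=
  1 / ((n%:R + 1) * sin (pi / (n%:R + 1))) *
  ((n%:R - k%:R) * cos (k%:R * pi / (n%:R + 1)) * sin (pi / (n%:R + 1))
   + sin (pi * (n%:R - k%:R) / (n%:R + 1))).

Definition A_curve (R : realType) (n : nat) (t s : R) : R[i] :=
  \sum_(1 <= k < n) (a_coef R n k)%:C * ((- t) ^+ (k - 1))%:C * expi (s * k%:R).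

(* Main.v *)
(** With [x = pi / (n + 1)], the unit vector whose [m]-th entry is
    [sqrt (2 / (n + 1)) * sin (m x) * e^(i s m)] (up to a global phase) is the
    witness: the [k]-th superdiagonal of [A_t] contributes [(-t)^(k-1) e^(isk)]
    times the [k]-th autocorrelation of the sine sequence, which is
    [a_(n,k)] because [2 sin x sin a sin b] telescopes along [b - a = k x]
    up to the term [cos (k x)].  The case [k = 0] is the normalization
    [a_(n,0) = 1]. *)
Require Import Defs.
From mathcomp Require Import all_boot all_order all_algebra.
From mathcomp Require Import spectral complex.
From mathcomp Require Import boolp classical_sets set_interval reals trigo.
From mathcomp Require Import zify ring lra.

Import Order.TTheory GRing.Theory Num.Theory.

Local Open Scope classical_set_scope.
Local Open Scope ring_scope.

(** The substitution [j = i + k] followed by an exchange of sums; it isolates each superdiagonal of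
    [A_mx], on which both the matrix entry and the phase are constant. *)
Lemma sum_upper_diagonals (V : nmodType) (n : nat) (F : nat -> nat -> V) :
  \sum_(i < n) \sum_(j < n | (i < j)%N) F i j =
  \sum_(1 <= k < n) \sum_(0 <= i < n - k) F i (i + k)%N.
Proof.
transitivity (\sum_(0 <= i < n) \sum_(1 <= k < n | (i + k < n)%N) F i (i + k)%N).
  rewrite big_mkord; apply: eq_bigr => i _.
  rewrite -(big_geq_mkord i.+1 n xpredT (F i)) -addn1 addnC big_addn.
  rewrite (big_nat_widen _ _ n) ?leq_subr //.
  by apply: eq_big => [k|k _]; [lia | rewrite addnC].
rewrite (exchange_big_dep_nat xpredT) //=.
apply: eq_bigr => k _; rewrite [RHS](big_nat_widen _ _ n) ?leq_subr //.
by apply: eq_bigl => i; lia.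
Qed.

Section SineAutocorrelation.
Variable R : realType.
Implicit Types (s x : R) (k m n : nat).

(** With [a = (i + 1) x] and [b = (i + k + 1) x], the product formulas give [4 sin x sin a sin b = 2
    cos (k x) sin x - (sin (a + b + x) - sin (a + b - x))]. Since [a + b = (2 i + k + 2) x], the
    bracket telescopes in [i]. *)
Lemma mul_sin_sum_sin_sin x k m :
  sin x * (4 * \sum_(0 <= i < m) sin (i.+1%:R * x) * sin ((i + k).+1%:R * x)) =
  2 * m%:R * cos (k%:R * x) * sin x + sin (k.+1%:R * x)
  - sin ((2 * m + k).+1%:R * x).
Proof.
elim: m => [|m IHm]; first by rewrite big_nil muln0 add0n; ring.
rewrite big_nat_recr //= 2!mulrDr IHm.
set a := m.+1%:R * x; set b := (m + k).+1%:R * x.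
have -> : k%:R * x = b - a by rewrite /a /b -!natr1 natrD; ring.
have -> : (2 * m + k).+1%:R * x = (a + b) - x.
  by rewrite /a /b -!natr1 !natrD; ring.
have -> : (2 * m.+1 + k).+1%:R * x = (a + b) + x.
  rewrite (_ : (2 * m.+1 + k).+1 = ((m.+1 + (m + k).+1).+1)%N); last lia.
  by rewrite -natr1 natrD /a /b; ring.
(* [sin (a + b)] stays unexpanded: its terms [sin (a + b) cos x] agree on both sides, so the
   identity is polynomial in the remaining atoms. *)
rewrite -[m.+1%:R in RHS]natr1 sinB (sinD (a + b)) cosB cosD; ring.
Qed.

Lemma sin_pi_div_gt0 n : (0 < n)%N -> 0 < sin (pi / (n%:R + 1) : R).
Proof.
move=> n_gt0; have n1_gt0 : 0 < n%:R + 1 :> R by rewrite natr1 ltr0n.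
apply: sin_gt0_pi; rewrite divr_gt0 ?pi_gt0 //=.
by rewrite ltr_pdivrMr // ltr_pMr ?pi_gt0 // ltrDr ltr0n.
Qed.

(** Since [(n + 1) x = pi], the angles of the two boundary terms left by telescoping are
    [pi - (n - k) x] and [pi + (n - k) x]. The terms therefore add up to [2 sin ((n - k) x)], the
    last summand in [a_coef]. *)
Lemma sum_sin_sin_a_coef n k : (0 < n)%N -> (k <= n)%N ->
  \sum_(0 <= i < n - k) sin (i.+1%:R * (pi / (n%:R + 1))) *
                        sin ((i + k).+1%:R * (pi / (n%:R + 1)))
  = (n%:R + 1) / 2 * a_coef R n k.
Proof.
move=> n_gt0 le_kn; rewrite /a_coef.
have n1_gt0 : 0 < n%:R + 1 :> R by rewrite natr1 ltr0n.
have sinx_gt0 := sin_pi_div_gt0 _ n_gt0.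
set x := pi / (n%:R + 1) in sinx_gt0 *.
have xE : n%:R * x + x = pi by rewrite /x; field; lra.
have := mul_sin_sum_sin_sin x k (n - k).
set S := \sum_(_ <= _ < _) _ => sumE.
have -> : k%:R * pi / (n%:R + 1) = k%:R * x by rewrite mulrA.
have -> : pi * (n%:R - k%:R) / (n%:R + 1) = (n%:R - k%:R) * x.
  by rewrite mulrAC mulrC.
have sinE1 : sin (k.+1%:R * x) = sin ((n%:R - k%:R) * x).
  have -> : (n%:R - k%:R) * x = - (k.+1%:R * x) + pi.
    by rewrite -xE -natr1; ring.
  by rewrite sinDpi sinN opprK.
have sinE2 : sin ((2 * (n - k) + k).+1%:R * x) = - sin ((n%:R - k%:R) * x).
  have -> : (2 * (n - k) + k).+1%:R * x = (n%:R - k%:R) * x + pi.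
    by rewrite -xE -natr1 natrD natrM natrB //; ring.
  by rewrite sinDpi.
rewrite sinE1 sinE2 natrB // in sumE.
apply: (@mulfI _ (sin x * 4)); first by rewrite mulf_neq0 ?pnatr_eq0 ?lt0r_neq0.
rewrite -[LHS]mulrA sumE; field.
by rewrite !lt0r_neq0.
Qed.

Lemma a_coef0 n : (0 < n)%N -> a_coef R n 0 = 1.
Proof.
move=> n_gt0; have n1_gt0 : 0 < n%:R + 1 :> R by rewrite natr1 ltr0n.
have sinx_gt0 := sin_pi_div_gt0 _ n_gt0.
rewrite /a_coef subr0 mul0r mul0r cos0 mulr1.
have -> : pi * n%:R / (n%:R + 1) = - (pi / (n%:R + 1)) + pi :> R.
  by field; exact: lt0r_neq0.
by rewrite sinDpi sinN opprK; field; rewrite !lt0r_neq0.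
Qed.

(** Here [sin (pi - 2 x) = 2 sin x cos x] raises the factor [n - 1] to [n + 1], which cancels the
    denominator. *)
Lemma a_coef1 n : (0 < n)%N -> a_coef R n 1 = cos (pi / (n%:R + 1)).
Proof.
move=> n_gt0; have n1_gt0 : 0 < n%:R + 1 :> R by rewrite natr1 ltr0n.
have sinx_gt0 := sin_pi_div_gt0 _ n_gt0.
rewrite /a_coef !mul1r; set x := pi / (n%:R + 1) in sinx_gt0 *.
have -> : pi * (n%:R - 1) / (n%:R + 1) = - (x + x) + pi.
  by rewrite /x; field; exact: lt0r_neq0.
by rewrite sinDpi sinN opprK sinD; field; rewrite !lt0r_neq0.
Qed.

Lemma expiD s1 s2 : expi (s1 + s2) = expi s1 * expi s2.
Proof.
by apply/eqP; rewrite eq_complex /= cosD sinD eqxx [X in X == _]addrC eqxx.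
Qed.

Lemma expi0 : expi (0 : R) = 1.
Proof. by rewrite /expi cos0 sin0. Qed.

Lemma conj_real_expi x s : (x%:C%C * expi s)^* = x%:C%C * expi (- s).
Proof. by rewrite rmorphM /= /expi cosN sinN; congr (_ * _); exact: conjc_real. Qed.

End SineAutocorrelation.

Theorem proposition5p1 (R : realType) (n : nat) (hn : (2 <= n)%N)
    (t : R) (ht : -1 < t < 1) :
  a_coef R n 1 = cos (pi / (n%:R + 1)) /\
  [set A_curve n t s | s in `[0, 2 * pi[ ] `<=` numerical_range (A_mx n t).
Proof.
have n_gt0 : (0 < n)%N by apply: ltnW.
split; first exact: a_coef1.
move=> _ [s _ <-].
pose x : R := pi / (n%:R + 1).
(* Indices start at 0, hence [j.+1] in the sine; the phase [s * j] of [v] omits this shift, at the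
   cost of a global factor [e^(-is)]. *)
pose f (j : nat) : R := sin (j.+1%:R * x).
pose c : R := Num.sqrt (2 / (n%:R + 1)).
pose v : 'cV[R[i]]_n := \col_j ((c * f j)%:C%C * expi (s * j%:R)).
have cc : c * c = 2 / (n%:R + 1).
  by rewrite -expr2 sqr_sqrtr // divr_ge0 // natr1.
have vJ i j : v i 0 * (v j 0)^* =
    (2 / (n%:R + 1) * (f i * f j))%:C%C * expi (s * i%:R - s * j%:R).
  rewrite !mxE conj_real_expi.
  by rewrite expiD -cc mulrACA -rmorphM /= [(c * _) * (c * _)]mulrACA.
have sumE k : (k <= n)%N ->
    2 / (n%:R + 1) * (\sum_(0 <= i < n - k) f i * f (i + k)%N) = a_coef R n k.
  move=> le_kn; rewrite sum_sin_sin_a_coef //; field.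
  by rewrite natr1 pnatr_eq0.
have ipE (y z : 'cV[R[i]]_n) : inner_product y z = \sum_i y i 0 * (z i 0)^*.
  by rewrite /inner_product dotmxE !mxE; apply: eq_bigr => i _; rewrite !mxE.
exists v.
  rewrite /= /euclidean_norm ipE (_ : \sum_i _ = 1) ?sqrtC1 //.
  under eq_bigr => i _ do rewrite vJ subrr expi0 mulr1.
  (* The squared norm is the autocorrelation at shift 0. *)
  rewrite -rmorph_sum -mulr_sumr /= -(big_mkord xpredT (fun i => f i * f i)).
  rewrite (_ : _ * _ = 1) // -[RHS](a_coef0 R _ n_gt0) -sumE // subn0.
  by congr (_ * _); apply: eq_bigr => i _; rewrite addn0.
rewrite ipE.
(* The summand at entry [(i, j)], as a function of natural numbers so that [i + k] can replace [j];
   the phase then becomes [s * k], free of [i]. *)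
pose G i j := ((- t) ^+ (j - i - 1))%:C%C *
  ((2 / (n%:R + 1) * (f j * f i))%:C%C * expi (s * j%:R - s * i%:R)).
transitivity (\sum_(i < n) \sum_(j < n | (i < j)%N) G i j).
  apply: eq_bigr => i _; rewrite mxE mulr_suml [RHS]big_mkcond.
  apply: eq_bigr => j _; rewrite mxE; case: ifP => _; last by rewrite !mul0r.
  by rewrite -mulrA vJ.
rewrite sum_upper_diagonals; apply: eq_big_nat => k /andP[_ lt_kn].
rewrite -sumE ?(ltnW lt_kn) // mulr_sumr rmorph_sum -mulrA mulr_suml.
apply: eq_bigr => i _ /=; rewrite /G addKn mulrCA [f (i + k)%N * _]mulrC.
by congr (_ * (_ * expi _)); rewrite natrD; ring.
Qed.
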